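(* Let $E$ be a complex Banach space with the property that each operator in $\mathcal{B}(E)$ has totally disconnected (for example, countable) spectrum. Then both $\mathcal{B}(E)$ and $\mathcal{Q}(E)$ have weakly open multiplication.
   Context: $\mathcal{B}(E)$ is the Banach algebra of all bounded linear operators on $E$, $\mathcal{K}(E)$ is its closed ideal of compact operators, and $\mathcal{Q}(E)=\mathcal{B}(E)/\mathcal{K}(E)$ is the quotient (Calkin) algebra. A map $T\colon X\to Y$ between metric spaces is weakly open if for every non-empty open set $U\subseteq X$ the image $T[U]$ has non-empty interior. A Banach algebra $A$ has weakly open multiplication if the map $A\times A\to A$, $(a,b)\mapsto ab$, is weakly open. *)

(* Defs.v *)
From HB Require Import structures.
From mathcomp Require Import all_boot all_order all_algebra.
From mathcomp Require Import complex.
From mathcomp Require Import all_classical all_reals all_analysis.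

Set Implicit Arguments.
Unset Strict Implicit.
Unset Printing Implicit Defensive.

Import Order.TTheory GRing.Theory Num.Theory.
Import numFieldNormedType.Exports.

Local Open Scope classical_set_scope.
Local Open Scope ring_scope.
Local Open Scope complex_scope.

(* The usual topology of the complex plane. The library attaches topologies to
   abstract numFieldTypes only, so that the concrete type R[i] needs its own
   instance. *)
HB.instance Definition _ (R : realType) := NormedModule.copy R[i] R[i]^o.

(* Rings are possibly zero: B(E) is zero when E is, and Q(E) is zero when E is
   finite-dimensional. A structure joining NormedModule and PzRing cannot be
   inserted below the existing NumDomain, so the normed algebra laws of B(E) and
   Q(E) are stated as lemmas (operator_scaleAl, calkin_scaleAl, etc). *)
#[short(type="preTopologicalPzRingType")]
HB.structure Definition PreTopologicalPzRing :=
  {A of Topological A & GRing.PzRing A}.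

Definition weakly_open {X Y : topologicalType} (f : X -> Y) :=
  forall U : set X, open U -> U !=set0 -> (f @` U)° !=set0.

Definition weakly_open_multiplication (A : preTopologicalPzRingType) :=
  weakly_open (fun ab : A * A => ab.1 * ab.2).

Definition invertible {A : pzRingType} (a : A) :=
  exists b, a * b = 1 /\ b * a = 1.

(* Norms of normed spaces over R[i] take values in R[i]; this is the same norm
   with values in R, where suprema and infima are available. *)
Definition rnorm {R : realType} {V : normedZmodType R[i]} (x : V) : R :=
  complex.Re `|x|.

Section rnorm_theory.
Variable R : realType.

Lemma rnormE (V : normedZmodType R[i]) (x : V) : `|x| = (rnorm x)%:C.
Proof. by rewrite /rnorm RRe_real// normr_real. Qed.

Lemma rnorm_ge0 (V : normedZmodType R[i]) (x : V) : 0 <= rnorm x.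
Proof. by rewrite -ler0c -rnormE. Qed.

Lemma ler_rnormD (V : normedZmodType R[i]) (x y : V) :
  rnorm (x + y) <= rnorm x + rnorm y.
Proof. by rewrite -lecR rmorphD/= -!rnormE ler_normD. Qed.

Lemma rnorm0 (V : normedZmodType R[i]) : rnorm (0 : V) = 0.
Proof. by rewrite /rnorm normr0. Qed.

Lemma rnorm_eq0 (V : normedZmodType R[i]) (x : V) : rnorm x = 0 -> x = 0.
Proof. by move=> x0; apply: normr0_eq0; rewrite rnormE x0. Qed.

Lemma rnormZ (V : normedModType R[i]) (a : R[i]) (x : V) :
  rnorm (a *: x) = rnorm a * rnorm x.
Proof. by apply: complexI; rewrite rmorphM/= -!rnormE normrZ. Qed.

Lemma rnorm_real (a : R) : 0 <= a -> rnorm a%:C = a.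
Proof. by move=> a0; rewrite /rnorm ger0_norm ?ler0c. Qed.

End rnorm_theory.

Section bounded_operators.
Variables (R : realType) (E : normedModType R[i]).

Definition bounded_op : {pred E -> E} := [pred f | `[<
  linear f /\ exists M : R, forall x, `|f x| <= M%:C * `|x| >]].

Lemma bounded_opP (f : E -> E) : reflect
  (linear f /\ exists M : R, forall x, rnorm (f x) <= M * rnorm x)
  (f \in bounded_op).
Proof.
apply: (iffP (asboolP _)) => -[lf [M fM]]; split=> //; exists M => x.
  by rewrite -lecR rmorphM/= -!rnormE.
by rewrite !rnormE -rmorphM lecR.
Qed.

Lemma bounded_op_subsemimod_closed : subsemimod_closed bounded_op.
Proof.
split; [split|].
- apply/bounded_opP; split; first by move=> a x y; rewrite scaler0 addr0.
  by exists 0 => x; rewrite rnorm0 mul0r.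
- move=> f g /bounded_opP[lf [M fM]] /bounded_opP[lg [N gN]].
  apply/bounded_opP; split.
    by move=> a x y; rewrite !addrfctE lf lg scalerDr addrACA.
  exists (M + N) => x; rewrite addrfctE mulrDl.
  by rewrite (le_trans (ler_rnormD _ _))// lerD.
- move=> a f /bounded_opP[lf [M fM]]; apply/bounded_opP; split.
    move=> b x y; rewrite !scalrfctE lf scalerDr !scalerA.
    by rewrite (mulrC a b).
  exists (rnorm a * M) => x; rewrite scalrfctE rnormZ -mulrA.
  by rewrite ler_wpM2l ?rnorm_ge0.
Qed.

Record bounded_operator := Operator { opfun :> E -> E ; _ : opfun \in bounded_op }.

HB.instance Definition _ := [isSub for opfun].
HB.instance Definition _ := [Choice of bounded_operator by <:].
HB.instance Definition _ := GRing.SubChoice_isSubLmodule.Build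
  R[i] (E -> E) bounded_op bounded_operator bounded_op_subsemimod_closed.

Implicit Types (S T : bounded_operator).

Lemma operatorP S T : (forall x, S x = T x) -> S = T.
Proof. by move=> ST; apply/val_inj/funext. Qed.

Lemma operator_linear T : linear T.
Proof. by case: T => f /= /bounded_opP[]. Qed.

HB.instance Definition _ T :=
  GRing.isLinear.Build R[i] E E *:%R (opfun T) (operator_linear T).

Lemma operatorD S T x : (S + T) x = S x + T x. Proof. by []. Qed.
Lemma operatorZ a T x : (a *: T) x = a *: T x. Proof. by []. Qed.
Lemma operatorN T x : (- T) x = - T x. Proof. by []. Qed.

Lemma operator1_bounded : idfun \in bounded_op.
Proof. by apply/bounded_opP; split=> //; exists 1 => x; rewrite mul1r. Qed.

Definition operator1 := Operator operator1_bounded.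

Lemma operatorM_bounded S T : S \o T \in bounded_op.
Proof.
apply/bounded_opP; split; first by move=> a x y /=; rewrite !linearP.
case: S T => [f /bounded_opP[_ [M fM]]] [g /bounded_opP[_ [N gN]]] /=.
exists (`|M| * N) => x.
apply: (le_trans (fM _)); rewrite -mulrA.
rewrite (@le_trans _ _ (`|M| * rnorm (g x)))//.
  by rewrite ler_wpM2r ?rnorm_ge0 ?ler_norm.
by rewrite ler_wpM2l.
Qed.

Definition operatorM S T := Operator (operatorM_bounded S T).

Lemma operatorMA : associative operatorM.
Proof. by move=> S T U; apply: operatorP. Qed.
Lemma operator1M : left_id operator1 operatorM.
Proof. by move=> T; apply: operatorP. Qed.
Lemma operatorM1 : right_id operator1 operatorM.
Proof. by move=> T; apply: operatorP. Qed.
Lemma operatorMDl : left_distributive operatorM +%R.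
Proof. by move=> S T U; apply: operatorP. Qed.
Lemma operatorMDr : right_distributive operatorM +%R.
Proof. by move=> S T U; apply: operatorP => x; exact: linearD. Qed.

HB.instance Definition _ := GRing.Zmodule_isPzRing.Build bounded_operator
  operatorMA operator1M operatorM1 operatorMDl operatorMDr.

Lemma operatorME S T x : (S * T) x = S (T x). Proof. by []. Qed.

Definition opnorm T : R := sup [set rnorm (T x) | x in [set x | `|x| <= 1]].

Let opset_has_sup T : has_sup [set rnorm (T x) | x in [set x | `|x| <= 1]].
Proof.
split; first by exists (rnorm (T 0)), 0; rewrite //= normr0.
case: T => f /= /bounded_opP[_ [M fM]]; exists `|M| => _ [x /= x1 <-].
apply: (le_trans (fM x)); apply: (@le_trans _ _ (`|M| * rnorm x)).
  by rewrite ler_wpM2r ?rnorm_ge0 ?ler_norm.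
by rewrite ler_piMr// -lecR -rnormE.
Qed.

Lemma opnorm_ge0 T : 0 <= opnorm T.
Proof.
apply: (le_trans (rnorm_ge0 (T 0))); apply: sup_upper_bound => //.
by exists 0; rewrite //= normr0.
Qed.

Lemma le_opnorm T x : rnorm (T x) <= opnorm T * rnorm x.
Proof.
have [->|x0] := eqVneq x 0; first by rewrite linear0 rnorm0 mulr0.
have x_gt0 : 0 < rnorm x.
  by rewrite lt_neqAle rnorm_ge0 eq_sym andbT; apply: contra_neq x0 => /rnorm_eq0.
rewrite -ler_pdivrMr//; apply: sup_upper_bound => //.
exists ((rnorm x)^-1%:C *: x); last first.
  by rewrite linearZ/= rnormZ rnorm_real ?invr_ge0 ?rnorm_ge0// mulrC.
rewrite /= rnormE rnormZ rnorm_real ?invr_ge0 ?rnorm_ge0//.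
by rewrite mulVf ?gt_eqF.
Qed.

Lemma opnorm_le T (M : R) : 0 <= M ->
  (forall x, rnorm (T x) <= M * rnorm x) -> opnorm T <= M.
Proof.
move=> M0 TM; apply: ge_sup; first exact: (opset_has_sup T).1.
move=> _ [x /= x1 <-]; apply: (le_trans (TM x)).
by rewrite ler_piMr// -lecR -rnormE.
Qed.

Let ler_opnormD S T : (opnorm (S + T))%:C <= (opnorm S)%:C + (opnorm T)%:C.
Proof.
rewrite -rmorphD lecR; apply: opnorm_le => [|x].
  by rewrite addr_ge0 ?opnorm_ge0.
by rewrite operatorD (le_trans (ler_rnormD _ _))// mulrDl lerD ?le_opnorm.
Qed.

Let opnormZ_le a T : opnorm (a *: T) <= rnorm a * opnorm T.
Proof.
apply: opnorm_le => [|x]; first by rewrite mulr_ge0 ?rnorm_ge0 ?opnorm_ge0.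
by rewrite operatorZ rnormZ -mulrA ler_wpM2l ?rnorm_ge0 ?le_opnorm.
Qed.

Let opnormZ a T : (opnorm (a *: T))%:C = `|a| * (opnorm T)%:C.
Proof.
rewrite (rnormE a) -rmorphM; congr (_%:C); apply/eqP.
rewrite eq_le opnormZ_le/=; have [->|a0] := eqVneq a 0.
  by rewrite rnorm0 mul0r opnorm_ge0.
have ra_gt0 : 0 < rnorm a.
  by rewrite lt_neqAle rnorm_ge0 eq_sym andbT; apply: contra_neq a0 => /rnorm_eq0.
rewrite -ler_pdivlMl//.
have {1}-> : T = a^-1 *: (a *: T) by rewrite scalerA mulVf// scale1r.
apply: (le_trans (opnormZ_le _ _)).
rewrite ler_wpM2r ?opnorm_ge0// -lecR -rnormE normfV rnormE.
by rewrite fmorphV.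
Qed.

Let opnorm_eq0 T : (opnorm T)%:C = 0 -> T = 0.
Proof.
move=> /complexI T0; apply: operatorP => x; apply: rnorm_eq0; apply/eqP.
by rewrite eq_le rnorm_ge0 andbT (le_trans (le_opnorm _ _))// T0 mul0r.
Qed.

HB.instance Definition _ := Lmodule_isNormed.Build R[i] bounded_operator
  ler_opnormD opnormZ opnorm_eq0.

Lemma opnormE T : `|T| = (opnorm T)%:C. Proof. by []. Qed.

Lemma rnorm_opnorm T : rnorm T = opnorm T. Proof. by []. Qed.

Lemma operator_scaleAl (k : R[i]) S T : k *: (S * T) = (k *: S) * T.
Proof. by apply: operatorP. Qed.

Lemma operator_scaleAr (k : R[i]) S T : k *: (S * T) = S * (k *: T).
Proof.
by apply: operatorP => x; rewrite operatorZ !operatorME operatorZ linearZ.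
Qed.

Lemma operator_normM S T : `|S * T| <= `|S| * `|T|.
Proof.
rewrite !opnormE -rmorphM lecR; apply: opnorm_le => [|x].
  by rewrite mulr_ge0 ?opnorm_ge0.
rewrite operatorME (le_trans (le_opnorm _ _))// -mulrA.
by rewrite ler_wpM2l ?opnorm_ge0 ?le_opnorm.
Qed.

Lemma operator_continuous T : continuous T.
Proof.
apply: bounded_linear_continuous; apply/linear_boundedP.
exists (opnorm T)%:C; split; first by rewrite complex_real.
move=> M TM x; apply: (@le_trans _ _ ((opnorm T)%:C * `|x|)).
  by rewrite !rnormE -rmorphM lecR le_opnorm.
by rewrite ler_wpM2r// ltW.
Qed.

Definition spectrum T : set R[i] := [set l | ~ invertible (l *: (1 : bounded_operator) - T)].

End bounded_operators.

Section compact_operators.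
Variables (R : realType) (E : normedModType R[i]).
Implicit Types (S T : bounded_operator E).

Definition compact_op : {pred bounded_operator E} :=
  [pred T : bounded_operator E | `[< precompact (T @` [set x | `|x| <= 1]) >]].

Lemma precompact_sub_compact (A K : set E) :
  compact K -> A `<=` K -> precompact A.
Proof.
move=> cK AK; apply: (precompact_subset AK).
by rewrite precompact_closed//; apply: compact_closed => //; exact: norm_hausdorff.
Qed.

Lemma compact_op0 : 0 \in compact_op.
Proof.
apply/asboolP; apply: (@precompact_sub_compact _ [set 0]); first exact: compact_set1.
by move=> _ [x _ <-].
Qed.

Lemma compact_opD S T :
  S \in compact_op -> T \in compact_op -> S + T \in compact_op.
Proof.
move=> /asboolP; rewrite precompactE => cS /asboolP; rewrite precompactE => cT.
apply/asboolP.
apply: (@precompact_sub_compact _ ((fun xy : E * E => xy.1 + xy.2) @`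
  (closure (S @` [set x | `|x| <= 1]) `*` closure (T @` [set x | `|x| <= 1])))).
  apply: continuous_compact; last exact: compact_setX.
  by apply: continuous_subspaceT => x; exact: add_continuous.
move=> _ [x x1 <-]; exists (S x, T x) => //.
by split; apply: subset_closure; exists x.
Qed.

Lemma compact_opMl S T : T \in compact_op -> S * T \in compact_op.
Proof.
move=> /asboolP; rewrite precompactE => cT; apply/asboolP.
apply: (@precompact_sub_compact _ (S @` closure (T @` [set x | `|x| <= 1]))).
  apply: continuous_compact => //.
  exact/continuous_subspaceT/operator_continuous.
move=> _ [x x1 <-]; exists (T x) => //.
by apply: subset_closure; exists x.
Qed.

Lemma compact_opZ a T : T \in compact_op -> a *: T \in compact_op.
Proof.
move=> cT; have -> : a *: T = (a *: (1 : bounded_operator E)) * T.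
  by rewrite -operator_scaleAl mul1r.
exact: compact_opMl.
Qed.

Lemma compact_opMr S T : S \in compact_op -> S * T \in compact_op.
Proof.
move=> cS; pose M := 1 + opnorm T.
have M0 : 0 < M by rewrite ltr_pwDl ?opnorm_ge0.
have : M%:C *: S \in compact_op by exact: compact_opZ.
move=> /asboolP pS; apply/asboolP; apply: precompact_subset pS.
move=> _ [x x1 <-]; exists (M^-1%:C *: T x); last first.
  rewrite operatorZ linearZ/= scalerA -rmorphM mulfV ?gt_eqF//.
  by rewrite scale1r.
have rx1 : rnorm x <= 1 by rewrite -lecR -rnormE.
rewrite /= rnormE -[1]/(1%:C) lecR rnormZ rnorm_real ?invr_ge0 ?(ltW M0)//.
rewrite ler_pdivrMl// mulr1 (le_trans (le_opnorm _ _))//.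
rewrite (@le_trans _ _ (opnorm T))//.
  by rewrite ler_piMr// opnorm_ge0.
by rewrite /M lerDr.
Qed.

Lemma compact_op_zmod_closed : zmod_closed compact_op.
Proof.
split=> [|S T cS cT]; first exact: compact_op0.
by rewrite compact_opD// -scaleN1r compact_opZ.
Qed.

HB.instance Definition _ :=
  GRing.isZmodClosed.Build (bounded_operator E) compact_op compact_op_zmod_closed.

End compact_operators.
Arguments compact_op {R E}.

Section compact_op_closed.
Variables (R : realType) (E : completeNormedModType R[i]).
Implicit Types (S T : bounded_operator E).

Lemma compact_op_lim T :
  (forall e : R, 0 < e -> exists2 S, S \in compact_op & opnorm (T - S) < e) ->
  T \in compact_op.
Proof.
move=> TS; set B := [set x : E | `|x| <= 1]; apply/asboolP.
rewrite precompactE compact_ultra => F UF FA.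
have Fc : cauchy F.
  apply: cauchy_exP => e e0.
  have [d d0 de] : exists2 d : R, 0 < d & e = (d *+ 3)%:C.
    exists (complex.Re e / 3).
      by rewrite divr_gt0// -ltcR RRe_real ?gtr0_real.
    by rewrite -(mulr_natr (_ / _)) divfK// RRe_real ?gtr0_real.
  have [S /asboolP + STd] := TS d d0; rewrite precompactE => cS.
  pose G := filter_from F (fun P => [set y | (S @` B) y /\
    exists2 x, P x & rnorm (x - y) < d *+ 2]).
  have GF : ProperFilter G.
    apply: filter_from_proper.
      apply: filter_from_filter; first by exists setT; exact: filterT.
      move=> P Q FP FQ; exists (P `&` Q); first exact: filterI.
      by move=> y [Sy [x [Px Qx] xy]]; split; split=> //; exists x.
    move=> P FP.
    have [x [Px /(_ (ball x d%:C))]] := filter_ex (filterI FP FA).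
    case; first by apply: nbhsx_ballx; rewrite ltcR.
    move=> _ [[z z1 <-]]; rewrite -ball_normE/= rnormE ltcR => xTz.
    exists (S z); split; first by exists z.
    exists x => //.
    have -> : x - S z = (x - T z) + (T - S) z.
      by rewrite operatorD operatorN addrA subrK.
    rewrite mulr2n (le_lt_trans (ler_rnormD _ _))// ltr_leD//.
    rewrite (le_trans (le_opnorm _ _))// (le_trans _ (ltW STd))//.
    by rewrite ler_piMr ?opnorm_ge0// -lecR -rnormE.
  have GS : G (closure (S @` B)).
    exists setT; first exact: filterT.
    by move=> y [Sy _]; exact: subset_closure.
  have [p [_ Gp]] := cS G GF GS.
  exists p; rewrite de.
  have [//|FN] := in_ultra_setVsetC (ball p (d *+ 3)%:C) UF.
  exfalso.
  have [] := Gp [set y | (S @` B) y /\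
    exists2 x, (~` ball p (d *+ 3)%:C) x & rnorm (x - y) < d *+ 2] (ball p d%:C).
  - by exists (~` ball p (d *+ 3)%:C).
  - by apply: nbhsx_ballx; rewrite ltcR.
  move=> y [[_ [x /= px xy]] py]; apply: px; move: py.
  rewrite -!ball_normE/= !rnormE !ltcR => py.
  have -> : p - x = (p - y) - (x - y) by rewrite opprB addrA subrK.
  rewrite mulrS (le_lt_trans (ler_rnormD _ _))// ltrD//.
  by rewrite {1}/rnorm normrN.
have /cvg_ex [p Fp] : cvg F by exact: cauchy_cvg.
exists p; split => //.
by apply: (@closed_cvg _ _ F _ id (closure (T @` B))) => //; exact: closed_closure.
Qed.

End compact_op_closed.

Section calkin.
Local Open Scope quotient_scope.
Variables (R : realType) (E : completeNormedModType R[i]).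
Implicit Types (S T : bounded_operator E).

Definition calkin := {ideal_quot (@compact_op R E)}.
HB.instance Definition _ := GRing.Zmodule.on calkin.
HB.instance Definition _ := Quotient.on calkin.

Local Notation pi := (\pi_calkin).

Lemma calkin_eqP S T : pi S = pi T <-> S - T \in compact_op.
Proof. by rewrite Quotient.idealrBE; split=> /eqP. Qed.

Lemma calkin_piD S T : pi (S + T) = pi S + pi T.
Proof. exact: Quotient.pi_add. Qed.

Lemma calkin_piN S : pi (- S) = - pi S.
Proof. exact: Quotient.pi_opp. Qed.

Lemma calkin_pi0 : pi 0 = 0.
Proof. by apply: (addrI (pi 0)); rewrite -calkin_piD !addr0. Qed.

Lemma calkin_piP (q : calkin) : exists T, q = pi T.
Proof. by exists (repr q); rewrite reprK. Qed.

Definition calkin_scale (a : R[i]) (q : calkin) : calkin := pi (a *: repr q).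
Definition calkin1 : calkin := pi 1.
Definition calkin_mul (p q : calkin) : calkin := pi (repr p * repr q).

Lemma calkin_scaleE a T : calkin_scale a (pi T) = pi (a *: T).
Proof.
apply/calkin_eqP; rewrite -scalerBr; apply: compact_opZ.
by apply/calkin_eqP; rewrite reprK.
Qed.

Lemma calkin_mulE S T : calkin_mul (pi S) (pi T) = pi (S * T).
Proof.
apply/calkin_eqP.
rewrite -(subrK (S * repr (pi T)) (_ * _)) -addrA -mulrBl -mulrBr.
apply: compact_opD.
  by apply: compact_opMr; apply/calkin_eqP; rewrite reprK.
by apply: compact_opMl; apply/calkin_eqP; rewrite reprK.
Qed.

Lemma calkin_scaleA a b q :
  calkin_scale a (calkin_scale b q) = calkin_scale (a * b) q.
Proof. by have [T ->] := calkin_piP q; rewrite !calkin_scaleE scalerA. Qed.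
Lemma calkin_scale1 : left_id 1 calkin_scale.
Proof. by move=> q; have [T ->] := calkin_piP q; rewrite calkin_scaleE scale1r. Qed.
Lemma calkin_scaleDr : right_distributive calkin_scale +%R.
Proof.
move=> a p q; have [S ->] := calkin_piP p; have [T ->] := calkin_piP q.
by rewrite -calkin_piD !calkin_scaleE -calkin_piD scalerDr.
Qed.
Lemma calkin_scaleDl q : {morph calkin_scale^~ q : a b / a + b}.
Proof.
move=> a b; have [T ->] := calkin_piP q.
by rewrite !calkin_scaleE -calkin_piD scalerDl.
Qed.

HB.instance Definition _ := GRing.Zmodule_isLmodule.Build R[i] calkin
  calkin_scaleA calkin_scale1 calkin_scaleDr calkin_scaleDl.

Lemma calkin_mulA : associative calkin_mul.
Proof.
move=> p q r; have [S ->] := calkin_piP p; have [T ->] := calkin_piP q.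
by have [U ->] := calkin_piP r; rewrite !calkin_mulE mulrA.
Qed.
Lemma calkin_mul1 : left_id calkin1 calkin_mul.
Proof. by move=> q; have [T ->] := calkin_piP q; rewrite calkin_mulE mul1r. Qed.
Lemma calkin_mulr1 : right_id calkin1 calkin_mul.
Proof. by move=> q; have [T ->] := calkin_piP q; rewrite calkin_mulE mulr1. Qed.
Lemma calkin_mulDl : left_distributive calkin_mul +%R.
Proof.
move=> p q r; have [S ->] := calkin_piP p; have [T ->] := calkin_piP q.
have [U ->] := calkin_piP r.
by rewrite -calkin_piD !calkin_mulE -calkin_piD mulrDl.
Qed.
Lemma calkin_mulDr : right_distributive calkin_mul +%R.
Proof.
move=> p q r; have [S ->] := calkin_piP p; have [T ->] := calkin_piP q.
have [U ->] := calkin_piP r.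
by rewrite -calkin_piD !calkin_mulE -calkin_piD mulrDr.
Qed.

HB.instance Definition _ := GRing.Zmodule_isPzRing.Build calkin
  calkin_mulA calkin_mul1 calkin_mulr1 calkin_mulDl calkin_mulDr.

Lemma calkin_piZ a T : pi (a *: T) = a *: pi T.
Proof. by rewrite -calkin_scaleE. Qed.

Lemma calkin_piM S T : pi (S * T) = pi S * pi T.
Proof. by rewrite -calkin_mulE. Qed.

Lemma calkin_pi1 : pi 1 = 1. Proof. by []. Qed.

Definition calkin_norm (q : calkin) : R :=
  inf [set opnorm T | T in [set T | pi T = q]].

Let calkin_set_has_inf q : has_inf [set opnorm T | T in [set T | pi T = q]].
Proof.
split; first by exists (opnorm (repr q)), (repr q) => //=; rewrite reprK.
by exists 0 => _ [T _ <-]; exact: opnorm_ge0.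
Qed.

Lemma calkin_norm_le T : calkin_norm (pi T) <= opnorm T.
Proof. by apply: ge_inf; [exact: (calkin_set_has_inf _).2|exists T]. Qed.

Lemma calkin_norm_lift q (e : R) : 0 < e ->
  exists2 T, pi T = q & opnorm T < calkin_norm q + e.
Proof.
by move=> e0; have [_ [T Tq <-] Te] := inf_adherent e0 (calkin_set_has_inf q); exists T.
Qed.

Lemma calkin_norm_ge0 q : 0 <= calkin_norm q.
Proof.
apply: lb_le_inf; first exact: (calkin_set_has_inf _).1.
by move=> _ [T _ <-]; exact: opnorm_ge0.
Qed.

Let ler_calkin_normD p q :
  (calkin_norm (p + q))%:C <= (calkin_norm p)%:C + (calkin_norm q)%:C.
Proof.
rewrite -rmorphD lecR; apply/ler_addgt0Pr => e e0.
have e20 : 0 < e / 2 by rewrite divr_gt0.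
have [S Sp Se] := calkin_norm_lift p e20.
have [T Tq Te] := calkin_norm_lift q e20.
rewrite -Sp -Tq -calkin_piD Sp Tq (le_trans (calkin_norm_le _))//.
have : opnorm (S + T) <= opnorm S + opnorm T.
  by rewrite -!rnorm_opnorm ler_rnormD.
move=> /le_trans; apply; rewrite [e]splitr addrACA.
by rewrite lerD// ltW.
Qed.

Let calkin_normZ_le (a : R[i]) q :
  calkin_norm (a *: q) <= rnorm a * calkin_norm q.
Proof.
apply/ler_addgt0Pr => e e0.
have a1 : 0 < rnorm a + 1 by rewrite ltr_wpDl ?rnorm_ge0.
have [T <- Te] := calkin_norm_lift q (divr_gt0 e0 a1).
rewrite -calkin_piZ (le_trans (calkin_norm_le _))//.
rewrite -rnorm_opnorm rnormZ rnorm_opnorm.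
rewrite (le_trans (ler_wpM2l (rnorm_ge0 a) (ltW Te)))// mulrDr lerD2l.
by rewrite mulrCA ler_piMr ?(ltW e0)// ler_pdivrMr// mul1r lerDl ler01.
Qed.

Let calkin_normZ (a : R[i]) q :
  (calkin_norm (a *: q))%:C = `|a| * (calkin_norm q)%:C.
Proof.
rewrite (rnormE a) -rmorphM; congr (_%:C); apply/eqP.
rewrite eq_le calkin_normZ_le/=; have [->|a0] := eqVneq a 0.
  by rewrite rnorm0 mul0r calkin_norm_ge0.
have ra_gt0 : 0 < rnorm a.
  by rewrite lt_neqAle rnorm_ge0 eq_sym andbT; apply: contra_neq a0 => /rnorm_eq0.
rewrite -ler_pdivlMl//.
have {1}-> : q = a^-1 *: (a *: q) by rewrite scalerA mulVf// scale1r.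
apply: (le_trans (calkin_normZ_le _ _)).
rewrite ler_wpM2r ?calkin_norm_ge0// -lecR -rnormE normfV rnormE.
by rewrite fmorphV.
Qed.

Let calkin_norm_eq0 q : (calkin_norm q)%:C = 0 -> q = 0.
Proof.
have [T ->] := calkin_piP q; move=> /complexI T0; rewrite -calkin_pi0.
apply/calkin_eqP; rewrite subr0; apply: compact_op_lim => e e0.
have [S ST Se] := calkin_norm_lift (pi T) e0.
exists (T - S); first by apply/calkin_eqP.
by rewrite subKr; move: Se; rewrite T0 add0r.
Qed.

HB.instance Definition _ := Lmodule_isNormed.Build R[i] calkin
  ler_calkin_normD calkin_normZ calkin_norm_eq0.

Lemma calkin_normE (q : calkin) : `|q| = (calkin_norm q)%:C. Proof. by []. Qed.

Lemma calkin_scaleAl (k : R[i]) (p q : calkin) : k *: (p * q) = (k *: p) * q.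
Proof.
have [S ->] := calkin_piP p; have [T ->] := calkin_piP q.
by rewrite -calkin_piM -!calkin_piZ -calkin_piM operator_scaleAl.
Qed.

Lemma calkin_scaleAr (k : R[i]) (p q : calkin) : k *: (p * q) = p * (k *: q).
Proof.
have [S ->] := calkin_piP p; have [T ->] := calkin_piP q.
by rewrite -calkin_piM -!calkin_piZ -calkin_piM operator_scaleAr.
Qed.

Let calkin_norm_lower (c M : R) (q : calkin) : 0 <= c ->
  (forall T, pi T = q -> M <= c * opnorm T) -> M <= c * calkin_norm q.
Proof.
move=> c0 cM; apply/ler_addgt0Pr => e e0.
have c1 : 0 < c + 1 by rewrite ltr_wpDl.
have [T Tq Te] := calkin_norm_lift q (divr_gt0 e0 c1).
rewrite (le_trans (cM T Tq))// (le_trans (ler_wpM2l c0 (ltW Te)))//.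
rewrite mulrDr lerD2l mulrCA ler_piMr ?(ltW e0)// ler_pdivrMr//.
by rewrite mul1r lerDl ler01.
Qed.

Lemma calkin_normM (p q : calkin) : `|p * q| <= `|p| * `|q|.
Proof.
rewrite !calkin_normE -rmorphM lecR.
apply: calkin_norm_lower => [|T <-]; first exact: calkin_norm_ge0.
rewrite mulrC; apply: calkin_norm_lower => [|S <-]; first exact: opnorm_ge0.
rewrite -calkin_piM (le_trans (calkin_norm_le _))// mulrC.
by have := operator_normM S T; rewrite !opnormE -rmorphM lecR.
Qed.

End calkin.

(* Main.v *)
(* A totally disconnected spectrum contains no segment of the real line, so
   T - t is invertible for arbitrarily small real t: the invertible elements are
   dense in B(E), hence also in the quotient Q(E). In an algebra A with dense
   invertible group multiplication is weakly open: a non-empty open subset of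
   A x A contains {a} x W with a invertible and W open, and aW is open. *)

Require Import Defs.
From mathcomp Require Import all_boot all_order all_algebra.
From mathcomp Require Import complex.
From mathcomp Require Import all_classical all_reals all_analysis.
Import Order.TTheory GRing.Theory Num.Theory.
Import numFieldNormedType.Exports.

Local Open Scope classical_set_scope.
Local Open Scope ring_scope.
Local Open Scope complex_scope.

Lemma dense_invertible_weakly_open (A : preTopologicalPzRingType) :
  (forall a : A, continuous (fun x : A => a * x)) ->
  dense [set a : A | invertible a] -> weakly_open_multiplication A.
Proof.
move=> cM dA U oU [[a b] Uab].
have : nbhs (a, b) U by exact: open_nbhs_nbhs.
move=> [[V W] /= [+ Wb] VW]; rewrite nbhsE => -[V' [oV' V'a] V'V].
have [c [V'c [d [cd dc]]]] := dA V' (ex_intro _ a V'a) oV'.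
(* As [d] is the inverse of [c], the translate [c W] is the preimage of [W] under left
   multiplication by [d]; continuity of that map makes it a neighbourhood of [c * b]. *)
exists (c * b); apply: (@filterS _ _ _ ((fun x => d * x) @^-1` W)) => /=.
  move=> x Wx; exists (c, d * x); last by rewrite /= mulrA cd mul1r.
  by apply: VW; split => //; exact: V'V.
by apply: cM; rewrite mulrA dc mul1r.
Qed.

Lemma lipschitz_estimate_continuous (K : numFieldType) (V W : normedModType K)
    (f : V -> W) (M : K) : 0 <= M ->
  (forall x y, `|f x - f y| <= M * `|x - y|) -> continuous f.
Proof.
(* [M] may be 0, so the division is by [M + 1]. *)
move=> M0 fM x; have M1 : 0 < M + 1 by rewrite ltr_wpDl.
apply/(@cvgrPdist_lt _ _ _ (nbhs x)) => e e0; near=> z.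
apply: (le_lt_trans (fM _ _)); apply: (@le_lt_trans _ _ ((M + 1) * `|x - z|)).
  by rewrite ler_wpM2r// lerDl.
rewrite -ltr_pdivlMl//.
by near: z; apply: cvgr_dist_lt => //; rewrite mulrC divr_gt0.
Unshelve. all: by end_near. Qed.

Lemma real_complex_continuous (R : realType) :
  continuous (fun t : R => (t%:C : R[i])).
Proof.
move=> x; apply/(@cvgrPdist_lt _ _ _ (nbhs x)) => e e0.
(* A positive element of [R[i]] is real, so the estimate can be carried out in [R]. *)
have eE : (complex.Re e)%:C = e by rewrite RRe_real ?gtr0_real.
near=> z; rewrite -rmorphB rnormE -eE ltcR /rnorm normc_def /= expr0n addr0.
rewrite sqrtr_sqr.
by near: z; apply: cvgr_dist_lt => //; rewrite -ltcR eE.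
Unshelve. all: by end_near. Qed.

Section dense_invertible.
Variables (R : realType) (E : completeNormedModType R[i]).

Lemma operator_mull_continuous (S : bounded_operator E) :
  continuous (fun T : bounded_operator E => S * T).
Proof.
apply: (@lipschitz_estimate_continuous _ _ _ _ `|S|) => // T U.
by rewrite -mulrBr operator_normM.
Qed.

Lemma calkin_mull_continuous (p : calkin E) :
  continuous (fun q : calkin E => p * q).
Proof.
apply: (@lipschitz_estimate_continuous _ _ _ _ `|p|) => // q r.
by rewrite -mulrBr calkin_normM.
Qed.

Local Notation pi := (\pi_(calkin E))%qT.

(** The quotient norm is an infimum over lifts, so [pi] is a contraction. *)
Lemma calkin_pi_continuous : continuous pi.
Proof.
apply: (@lipschitz_estimate_continuous _ _ _ _ 1) => // S T.
rewrite mul1r -calkin_piN -calkin_piD calkin_normE opnormE lecR.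
exact: calkin_norm_le.
Qed.

Lemma dense_invertible_operator :
  (forall T : bounded_operator E, totally_disconnected (spectrum T)) ->
  dense [set T : bounded_operator E | invertible T].
Proof.
move=> tdE O [T OT] oO; apply: contrapT => O0.
pose h (t : R) : bounded_operator E := T - t%:C *: (1 : bounded_operator E).
have ch : {for 0, continuous h}.
  apply: continuousB; first exact: cst_continuous.
  by apply: continuousZr_tmp; exact: real_complex_continuous.
have : nbhs (0 : R) (h @^-1` O).
  by apply: ch; rewrite /h scale0r subr0; exact: open_nbhs_nbhs.
move=> /nbhs_ballP[d /= d0 dO].
(* For small [t] the operator [h t] lies in [O], which is assumed free of invertibles; the sign
   change from [h t] to [t - T] does not affect invertibility. *)
have hs (t : R) : ball (0 : R) d t -> spectrum T t%:C.
  move=> /dO Ot [S [hS Sh]]; apply: O0; exists (h t); split=> //.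
  by exists (- S); rewrite /h -opprB !mulrNN.
(* Halving [d] keeps the closed segment inside the open ball. *)
pose I : set R := [set` `[0, d / 2]].
have Id t : I t -> ball (0 : R) d t.
  rewrite /I /= in_itv /= => /andP[t0 td].
  rewrite -ball_normE /= sub0r normrN ger0_norm//.
  by rewrite (le_lt_trans td)// ltr_pdivrMr// mulr2n mulrDr mulr1 ltrDl.
have cI : connected ((fun t : R => (t%:C : R[i])) @` I).
  apply: connected_continuous_connected.
    by apply/connected_intervalP; exact: interval_is_interval.
  by apply: continuous_subspaceT; exact: real_complex_continuous.
have d20 : 0 < d / 2 by rewrite divr_gt0.
have I0 : I 0 by rewrite /I /= in_itv /= lexx ltW.
have Id2 : I (d / 2) by rewrite /I /= in_itv /= lexx ltW.
(* The segment is connected and lies in the spectrum, so its distinct endpoints share a component,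
   against total disconnectedness. *)
have : connected_component (spectrum T) (0%:C) (d / 2)%:C.
  exists ((fun t : R => (t%:C : R[i])) @` I); last by exists (d / 2).
  by split=> //; [exists 0|move=> _ [t /Id/hs ? <-]].
rewrite tdE; last by apply: hs; exact: Id.
by move=> /complexI d2; rewrite d2 ltxx in d20.
Qed.

(** Since [pi] is continuous and onto, non-empty open sets pull back to non-empty open sets; being
    multiplicative and unital, it maps invertibles to invertibles. *)
Lemma dense_invertible_calkin :
  dense [set T : bounded_operator E | invertible T] ->
  dense [set q : calkin E | invertible q].
Proof.
move=> dE O [q Oq] oO; have [T qT] := calkin_piP q.
have [||S [OS [U [SU US]]]] := dE (pi @^-1` O).
- by exists T; rewrite /= -qT.
- by apply: open_comp => // x _; exact: calkin_pi_continuous.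
exists (pi S); split=> //; exists (pi U).
by rewrite -!calkin_piM SU US.
Qed.

End dense_invertible.

Theorem theorem4p17 (R : realType) (E : completeNormedModType R[i]) :
  (forall T : bounded_operator E, totally_disconnected (spectrum T)) ->
  weakly_open_multiplication (bounded_operator E) /\
  weakly_open_multiplication (calkin E).
Proof.
move=> /dense_invertible_operator dE; split.
  by apply: dense_invertible_weakly_open => //; exact: operator_mull_continuous.
apply: dense_invertible_weakly_open; first exact: calkin_mull_continuous.
exact: dense_invertible_calkin.
Qed.
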